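(* Let $V=V_1\uplus\cdots\uplus V_k$ be a finite ground set partitioned into disjoint nonempty sets, let $b_1,\dots,b_k$ be integers with $1\le b_i\le n_i:=|V_i|$, let $n=|V|$, $b=\sum_{i\in[k]}b_i$, $\bar n=\max_i n_i$, and let $f:2^V\to\mathbb{R}_{\ge 0}$ be monotone with $f(\emptyset)=0$. Let $\gamma,\alpha$ be the partition matroid diminishing-return ratio and partition matroid curvature of $f$ (defined in the context), let $0<\gamma'\le\gamma$ and $\alpha\le\alpha'\le1$, and let $\delta\in[0,1]$. Let $S_b$ be the output of the algorithm \textsc{FastProb} (described in the context), and let $S^*$ maximize $f(S)$ over $\{S\subseteq V:|S\cap V_i|\le b_i\ \forall i\}$. Then, with probability at least $1-\delta$, \textsc{FastProb} obtains a $\Big(\frac{1}{\gamma'}+\alpha'-1\Big)\Big(1-\frac{1}{\bar n+2}\Big)+1$-approximation solution, i.e. $f(S^* )\le\big[(\frac{1}{\gamma'}+\alpha'-1)(1-\frac{1}{\bar n+2})+1\big]\mathbb{E}[f(S_b)]$; and \textsc{FastProb} uses $O(n\ln b\ln\frac{b}{\delta})$ queries of $f$.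
   Context: Notation: $\Delta_e f(S):=f(S\cup\{e\})-f(S)$ for $e\notin S$. The PM diminishing-return ratio $\gamma$ is the maximum value in $[0,1]$ with $\Delta_e f(T)\le\frac1\gamma\Delta_e f(S)$ for all $S\subseteq T\subseteq V$ with $|(T\setminus S)\cap V_i|\le b_i\ \forall i\in[k]$ and all $e\in V\setminus T$; the PM curvature $\alpha$ is the minimum value in $[0,1]$ with $\Delta_e f(T)\ge(1-\alpha)\Delta_e f(S)$ for all such $S,T,e$. Algorithm \textsc{FastProb} (input: partition, $f$, $\gamma'$, $\alpha'$, $b_1,\dots,b_k$, $\delta$): set $I=[k]$, $S_0=\emptyset$, $t=0$. While $I\neq\emptyset$: for each $i\in I$ in turn: let $R_t$ be a set of $\min\big(\frac{n_i-|S_t\cap V_i|}{b_i-|S_t\cap V_i|}\ln\frac b\delta,\ |V_i\setminus S_t|\big)$ elements picked uniformly at random from $V_i\setminus S_t$; let $a=\big\lceil\frac{|R_t|+1}{1-\gamma'(1-\alpha')}\big\rceil-1$; choose $e_t\in R_t$ with probability $\frac{(\Delta_{e_t}f(S_t))^a}{\sum_{u\in R_t}(\Delta_u f(S_t))^a}$; set $S_{t+1}=S_t\cup\{e_t\}$, $t=t+1$; if $|S_t\cap V_i|\ge b_i$ remove $i$ from $I$. Return $S_b$.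
   Formalization: Query bound is for b≥2, δ>0 (at b=1 the formula is 0). |R_t| is rounded up, at least 1; if γ'(1−α')=1 or all weights vanish, e_t is uniform among elements of R_t of largest marginal. E[f(S_b)] is conditional on an event about the samples of probability ≥1−δ. *)

(* Defs.v *)
From HB Require Import structures.
From mathcomp Require Import all_boot all_order all_algebra.
From mathcomp Require Import reals exp.

Set Implicit Arguments.
Unset Strict Implicit.
Unset Printing Implicit Defensive.

Import Order.TTheory GRing.Theory Num.Theory.
Local Open Scope ring_scope.

Section SetFunctions.
Context {R : realType} {V : finType} {k : nat}.
Variables (Vs : 'I_k -> {set V}) (cap : 'I_k -> nat) (f : {set V} -> R).

Definition is_partition : Prop :=
  [/\ forall i, Vs i != set0,
      forall i j, i != j -> [disjoint Vs i & Vs j]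
    & \bigcup_(i : 'I_k) Vs i = [set: V]].

Definition monotone : Prop :=
  forall S T : {set V}, S \subset T -> f S <= f T.

Definition marginal (e : V) (S : {set V}) : R := f (e |: S) - f S.

Definition feasible (S : {set V}) : Prop :=
  forall i, (#|S :&: Vs i| <= cap i)%N.

Definition is_optimal (S : {set V}) : Prop :=
  feasible S /\ forall T, feasible T -> f T <= f S.

Definition pm_close (S T : {set V}) : Prop :=
  S \subset T /\ forall i, (#|(T :\: S) :&: Vs i| <= cap i)%N.

(* The guard [0 < g] is the convention 1/0 = +oo: g = 0 is always admissible. *)
Definition pm_dr_bound (g : R) : Prop :=
  forall (S T : {set V}) (e : V), pm_close S T -> e \notin T ->
    0 < g -> marginal e T <= g^-1 * marginal e S.

Definition pm_curvature_bound (a : R) : Prop :=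
  forall (S T : {set V}) (e : V), pm_close S T -> e \notin T ->
    (1 - a) * marginal e S <= marginal e T.

Definition is_pm_dr_ratio (gamma : R) : Prop :=
  [/\ 0 <= gamma <= 1, pm_dr_bound gamma
    & forall g, 0 <= g <= 1 -> pm_dr_bound g -> g <= gamma].

Definition is_pm_curvature (alpha : R) : Prop :=
  [/\ 0 <= alpha <= 1, pm_curvature_bound alpha
    & forall a, 0 <= a <= 1 -> pm_curvature_bound a -> alpha <= a].

End SetFunctions.

Section FastProb.
Context {R : realType} {V : finType} {k : nat}.
Variables (Vs : 'I_k -> {set V}) (cap : 'I_k -> nat) (f : {set V} -> R).
Variables (gamma' alpha' delta : R).

Definition budget : nat := (\sum_(i < k) cap i)%N.
Definition max_part : nat := (\max_(i < k) #|Vs i|)%N.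

(* Control state of the nested loops: [active] is the set I, [cur] is S_t, and
   [queue] lists the indices not yet visited by the current inner pass; when it
   is exhausted the outer loop starts a new pass over I, in increasing order. *)
Record state := State
  { active : {set 'I_k}; queue : seq 'I_k; cur : {set V} }.

Definition init_state : state := State [set: 'I_k] [::] set0.

Definition pending (st : state) : seq 'I_k :=
  if queue st is [::] then enum (active st) else queue st.

Definition next_state (st : state) (e : V) : state :=
  if pending st is i :: q then
    let S' := e |: cur st in
    State (if (cap i <= #|S' :&: Vs i|)%N then active st :\ i else active st)
          q S'
  else st.

(* |R_t|: the real prescribed size is rounded up.  For delta = 0 the logarithm
   is +oo, so the minimum is |V_i \ S|.  The floor at 1 only matters for
   budget = 1 and delta = 1, where the logarithm is 0 and the prescribed sample,
   from which an element has to be chosen, would be empty. *)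
Definition sample_size (i : 'I_k) (S : {set V}) : nat :=
  if delta == 0 then #|Vs i :\: S| else
  minn (maxn 1 `|Num.ceil ((#|Vs i|%:R - #|S :&: Vs i|%:R)
                            / ((cap i)%:R - #|S :&: Vs i|%:R)
                            * ln (budget%:R / delta))|%N)
       #|Vs i :\: S|.

Definition sample_prob (i : 'I_k) (S Rt : {set V}) : R :=
  if (Rt \subset Vs i :\: S) && (#|Rt| == sample_size i S)
  then ('C(#|Vs i :\: S|, sample_size i S))%:R^-1 else 0.

Definition exponent (Rt : {set V}) : nat :=
  `|Num.ceil ((#|Rt|%:R + 1) / (1 - gamma' * (1 - alpha')))|%N.-1.

Definition weight (S Rt : {set V}) (u : V) : R :=
  marginal f u S ^+ exponent Rt.

Definition argmaxs (S Rt : {set V}) : {set V} :=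
  [set e in Rt | [forall u in Rt, marginal f u S <= marginal f e S]].

(* The quotient prescribed for the choice of e_t is meaningless in two cases: an
   infinite exponent (gamma' (1 - alpha') = 1), and vanishing weights (all the
   marginals on Rt are 0).  In both e_t is uniform among the elements of Rt of
   largest marginal, which is the limit for an exponent tending to +oo in the
   first case, and uniform on Rt in the second. *)
Definition select_prob (S Rt : {set V}) (e : V) : R :=
  if (gamma' * (1 - alpha') == 1) || (\sum_(u in Rt) weight S Rt u == 0)
  then (if e \in argmaxs S Rt then #|argmaxs S Rt|%:R^-1 else 0)
  else (if e \in Rt then weight S Rt e / \sum_(u in Rt) weight S Rt u else 0).

(* An iteration is recorded as the pair (R_t, e_t).  The loops perform exactly
   [budget] iterations: the value 0 for a halted state is never used, see
   [traj_prob_sum1] and [run_halts] below. *)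
Definition step_prob (st : state) (x : {set V} * V) : R :=
  if pending st is i :: _ then
    sample_prob i (cur st) x.1 * select_prob (cur st) x.1 x.2
  else 0.

Fixpoint seq_prob (st : state) (s : seq ({set V} * V)) : R :=
  if s is x :: s' then step_prob st x * seq_prob (next_state st x.2) s' else 1.

Definition run (s : seq ({set V} * V)) : state :=
  foldl (fun st x => next_state st x.2) init_state s.

Definition trajectory := budget.-tuple ({set V} * V).

Definition traj_prob (w : trajectory) : R := seq_prob init_state w.

Definition output (w : trajectory) : {set V} := cur (run w).

Definition Pr (G : {set trajectory}) : R := \sum_(w in G) traj_prob w.

Definition cond_expect (G : {set trajectory}) (X : trajectory -> R) : R :=
  (\sum_(w in G) traj_prob w * X w) / Pr G.

(* G only constrains the sampling of the sets R_t: conditionally on G, given the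
   iterations before t and R_t, the element e_t still follows the selection rule
   of the algorithm.  Here w ranges over all possible pasts. *)
Definition sampling_event (G : {set trajectory}) : Prop :=
  forall (t : 'I_budget) (w : trajectory),
    Pr [set w' in G | take t.+1 w' == take t.+1 w]
    = select_prob (cur (run (take t w))) (tnth w t).1 (tnth w t).2
      * Pr [set w' in G | (take t w' == take t w)
                          && ((tnth w' t).1 == (tnth w t).1)].

(* The sets at which f is evaluated to get all the marginals on Rt at S. *)
Definition iter_queries (S Rt : {set V}) : seq {set V} :=
  S :: [seq u |: S | u <- enum Rt].

Definition num_queries (w : trajectory) : nat :=
  (\sum_(t < budget) size (iter_queries (cur (run (take t w))) (tnth w t).1))%N.

End FastProb.

Section Sanity.
Context {R : realType} {V : finType} {k : nat}.
Variables (Vs : 'I_k -> {set V}) (cap : 'I_k -> nat) (f : {set V} -> R).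
Variables (gamma' alpha' delta : R).
Hypothesis Vs_part : is_partition Vs.
Hypothesis cap_le : forall i, (1 <= cap i <= #|Vs i|)%N.

Let inv (st : @state V k) : Prop :=
  [/\ active st = [set i | (#|cur st :&: Vs i| < cap i)%N],
      uniq (queue st), {subset queue st <= active st}
    & forall i, (#|cur st :&: Vs i| <= cap i)%N].

Let left_ (st : @state V k) : nat :=
  (\sum_(i < k) (cap i - #|cur st :&: Vs i|))%N.

Lemma inv_init : inv init_state.
Proof.
split=> //= [|i]; last by rewrite set0I cards0.
by apply/setP => i; rewrite !inE set0I cards0; case/andP: (cap_le i) => ->.
Qed.

Lemma pendingP st : inv st ->
  uniq (pending st) /\ {subset pending st <= active st}.
Proof.
case=> _ u s _; rewrite /pending; case: (queue st) u s => [|//] _ _.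
by split; [exact: enum_uniq | move=> i; rewrite mem_enum].
Qed.

Lemma inv_next st i q e : inv st -> pending st = i :: q ->
  e \in Vs i :\: cur st ->
  inv (next_state Vs cap st e) /\
  left_ st = (left_ (next_state Vs cap st e)).+1.
Proof.
move=> I P /setDP [eV eS]; have [u s] := pendingP I.
rewrite /next_state P; rewrite P in u s.
have [aE _ _ le] := I; have [_ disj _] := Vs_part.
have ia : i \in active st by apply: s; rewrite inE eqxx.
have cj j : j != i -> (e |: cur st) :&: Vs j = cur st :&: Vs j.
  move=> ji; apply/setP => x; rewrite !inE.
  case: (eqVneq x e) => [->|//]; rewrite /= (negPf eS) /=.
  by rewrite (disjointFl (disj _ _ ji) eV).
have ci : #|(e |: cur st) :&: Vs i| = #|cur st :&: Vs i|.+1.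
  have -> : (e |: cur st) :&: Vs i = e |: (cur st :&: Vs i).
    by apply/setP => x; rewrite !inE; case: (eqVneq x e) => [->|//]; rewrite eV.
  by rewrite cardsU1 inE (negPf eS).
have lti : (#|cur st :&: Vs i| < cap i)%N by move: ia; rewrite aE inE.
have aE' : (if (cap i <= #|(e |: cur st) :&: Vs i|)%N then active st :\ i
    else active st) = [set j | (#|(e |: cur st) :&: Vs j| < cap j)%N].
  apply/setP => j; rewrite aE.
  case: (eqVneq j i) => [->|ji].
    by rewrite inE ci; case: leqP; rewrite !inE ?eqxx //= lti.
  by case: ifP => _; rewrite !inE ?ji ?cj.
split.
  split; rewrite //=; first by case/andP: u.
    move=> j jq; rewrite aE' inE.
    have ji : j != i by apply: contraTneq jq => ->; case/andP: u.
    have : j \in active st by apply: s; rewrite inE jq orbT.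
    by rewrite aE inE cj.
  by move=> j; case: (eqVneq j i) => [->|ji]; rewrite ?ci // cj.
rewrite /left_ /= (bigD1 i) //= [in RHS](bigD1 i) //= ci.
under [in RHS]eq_bigr => j ji do rewrite cj //.
by rewrite -addSn -subSn // subSS.
Qed.

Lemma pending_nil st : inv st -> (0 < left_ st)%N -> pending st != [::].
Proof.
case=> aE _ _ _; apply: contraTneq; rewrite /pending.
case: (queue st) => [E|//]; rewrite -eqn0Ngt /left_ sum_nat_eq0.
apply/forallP => i; rewrite /= subn_eq0 leqNgt.
apply/negP => H; have : i \in enum (active st) by rewrite mem_enum aE inE.
by rewrite E.
Qed.

Lemma sample_size_gt0 i S : (#|S :&: Vs i| < cap i)%N ->
  (0 < sample_size Vs cap delta i S)%N.
Proof.
move=> H; have m0 : (0 < #|Vs i :\: S|)%N.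
  rewrite cardsD subn_gt0 setIC; apply: leq_trans H _.
  by case/andP: (cap_le i).
by rewrite /sample_size; case: ifP => // _; rewrite leq_min m0 leq_max.
Qed.

Lemma sample_size_le i S :
  (sample_size Vs cap delta i S <= #|Vs i :\: S|)%N.
Proof. by rewrite /sample_size; case: ifP => // _; rewrite geq_minr. Qed.

Lemma sample_prob_sum1 i S :
  \sum_(Rt : {set V}) sample_prob Vs cap delta i S Rt = 1.
Proof.
rewrite /sample_prob -big_mkcond /= sumr_const.
set m := #|Vs i :\: S|; set r := sample_size _ _ _ _ _.
have -> : #|[pred Rt : {set V} | (Rt \subset Vs i :\: S) && (#|Rt| == r)]|
    = 'C(m, r).
  by rewrite -cards_draws; apply: eq_card => A; rewrite !inE.
rewrite -[LHS]mulr_natr mulVf // pnatr_eq0 -lt0n bin_gt0; exact: sample_size_le.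
Qed.

Lemma select_prob_sum1 S Rt : Rt != set0 ->
  \sum_(e : V) select_prob f gamma' alpha' S Rt e = 1.
Proof.
case/set0Pn => x0 x0R.
have [C|C] := boolP ((gamma' * (1 - alpha') == 1) ||
  (\sum_(u in Rt) weight f gamma' alpha' S Rt u == 0)).
  under eq_bigr do rewrite /select_prob C.
  rewrite -big_mkcond /= sumr_const -[LHS]mulr_natr mulVf // pnatr_eq0 -lt0n.
  apply/card_gt0P.
  case: (@arg_maxP _ _ _ x0 (mem Rt) (fun u => marginal f u S) x0R) => e eR H.
  exists e; rewrite inE; apply/andP; split; first exact: eR.
  by apply/forall_inP => u uR; exact: H.
under eq_bigr do rewrite /select_prob (negPf C).
by case/norP: C => _ nz; rewrite -big_mkcond /= -mulr_suml mulfV.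
Qed.

Lemma step_prob_sum1 st : inv st -> (0 < left_ st)%N ->
  \sum_(x : {set V} * V) step_prob Vs cap f gamma' alpha' delta st x = 1.
Proof.
move=> I L; have := pending_nil I L; rewrite /step_prob.
case P : (pending st) => [//|i q] _.
rewrite -(pair_bigA _ (fun Rt e => sample_prob Vs cap delta i (cur st) Rt *
  select_prob f gamma' alpha' (cur st) Rt e)) /=.
rewrite -[RHS](sample_prob_sum1 i (cur st)); apply: eq_bigr => Rt _.
rewrite -mulr_sumr; case: (eqVneq Rt set0) => [->|nz]; last first.
  by rewrite select_prob_sum1 ?mulr1.
rewrite /sample_prob cards0 ifF ?mul0r //.
apply/negbTE/nandP; right; rewrite eq_sym -lt0n; apply: sample_size_gt0.
have [_ s] := pendingP I; have [aE _ _ _] := I.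
by have := s i; rewrite P inE eqxx aE inE; exact.
Qed.

Lemma step_prob_supp st i q x : pending st = i :: q ->
  step_prob Vs cap f gamma' alpha' delta st x != 0 ->
  [/\ x.1 \subset Vs i :\: cur st,
      #|x.1| = sample_size Vs cap delta i (cur st) & x.2 \in x.1].
Proof.
move=> P; rewrite /step_prob P mulf_eq0 => /norP []; rewrite /sample_prob.
case: ifP => [/andP [-> /eqP ->] _|]; last by rewrite eqxx.
rewrite /select_prob; case: ifP => _; case: ifP; rewrite ?eqxx // => H _.
by split=> //; move: H; rewrite inE => /andP [].
Qed.

Lemma seq_prob_sum1 n st : inv st -> left_ st = n ->
  \sum_(w : n.-tuple ({set V} * V))
    seq_prob Vs cap f gamma' alpha' delta st w = 1.
Proof.
elim: n st => [|n IH] st I L.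
  rewrite (big_pred1 [tuple]) //= => w; apply/esym/eqP; exact: tuple0.
rewrite (reindex (fun p : ({set V} * V) * n.-tuple _ =>
  [tuple of p.1 :: p.2])) /=; last first.
  exists (fun w => (thead w, [tuple of behead w])) => [[x w] _|w _] /=.
    by congr (_, _); apply: val_inj.
  by rewrite [RHS]tuple_eta.
rewrite -(pair_bigA _ (fun x (w : n.-tuple _) =>
  step_prob Vs cap f gamma' alpha' delta st x *
  seq_prob Vs cap f gamma' alpha' delta (next_state Vs cap st x.2) w)) /=.
rewrite -[RHS](step_prob_sum1 I) ?L //; apply: eq_bigr => x _.
rewrite -mulr_sumr.
case: (eqVneq (step_prob Vs cap f gamma' alpha' delta st x) 0) => [->|nz].
  by rewrite mul0r.
have := pending_nil I; rewrite L => /(_ isT).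
case P : (pending st) => [//|i q] _.
have [sub _ xin] := step_prob_supp P nz.
have [I' L'] := inv_next I P (subsetP sub _ xin).
by rewrite IH ?mulr1 //; apply: succn_inj; rewrite -L' L.
Qed.

Lemma left_init : left_ init_state = budget cap.
Proof. by apply: eq_bigr => i _; rewrite set0I cards0 subn0. Qed.

Lemma traj_prob_sum1 :
  \sum_(w : trajectory cap) traj_prob Vs f gamma' alpha' delta w = 1.
Proof. exact: (seq_prob_sum1 inv_init left_init). Qed.

Lemma halts_from n st (w : n.-tuple ({set V} * V)) : inv st -> left_ st = n ->
  seq_prob Vs cap f gamma' alpha' delta st w != 0 ->
  let st' := foldl (fun st x => next_state Vs cap st x.2) st w in
  active st' = set0 /\ forall i, #|cur st' :&: Vs i| = cap i.
Proof.
elim: n st w => [|n IH] st w I L.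
  rewrite (tuple0 w) /= => _; have [aE _ _ le] := I.
  have Z i : (cap i <= #|cur st :&: Vs i|)%N.
    move/eqP: L; rewrite sum_nat_eq0 => /forallP /(_ i) /=.
    by rewrite subn_eq0.
  split; last by move=> i; apply/eqP; rewrite eqn_leq le Z.
  by rewrite aE; apply/setP => i; rewrite !inE ltnNge Z.
case/tupleP: w => x w /=; rewrite mulf_eq0 => /norP [nz].
have := pending_nil I; rewrite L => /(_ isT).
case P : (pending st) => [//|i q] _.
have [sub _ xin] := step_prob_supp P nz.
have [I' L'] := inv_next I P (subsetP sub _ xin).
by apply: IH => //; apply: succn_inj; rewrite -L' L.
Qed.

Lemma run_halts (w : trajectory cap) :
  traj_prob Vs f gamma' alpha' delta w != 0 ->
  active (run Vs cap w) = set0 /\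
  forall i, #|output Vs w :&: Vs i| = cap i.
Proof. exact: (halts_from inv_init left_init). Qed.

End Sanity.

Section Existence.
Context {R : realType} {V : finType} {k : nat}.
Variables (Vs : 'I_k -> {set V}) (cap : 'I_k -> nat) (f : {set V} -> R).
Hypothesis f_mono : monotone f.

Lemma marginal_ge0 e S : 0 <= marginal f e S.
Proof. by rewrite subr_ge0; apply: f_mono; exact: subsetUr. Qed.

Lemma pm_dr_ratio_exists : exists gamma, is_pm_dr_ratio Vs cap f gamma.
Proof.
pose A : classical_sets.set R :=
  fun g => 0 <= g <= 1 /\ pm_dr_bound Vs cap f g.
have A0 : A 0 by split; [rewrite lexx ler01 | move=> ? ? ? _ _; rewrite ltxx].
have An : classical_sets.nonempty A by exists 0.
have Aub : classical_sets.has_ubound A by exists 1 => g [/andP []].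
have s1 : sup A <= 1 by apply: ge_sup => // g [/andP []].
have le g : A g -> g <= sup A by move=> Ag; exact: ub_le_sup.
exists (sup A); split=> [|S T e cl eT s0|g g01 gb].
- by rewrite s1 andbT; exact: le.
- rewrite mulrC ler_pdivlMr // leNgt; apply/negP => lt.
  have T0 : 0 < marginal f e T.
    rewrite lt_neqAle marginal_ge0 andbT eq_sym; apply: contraTneq lt => ->.
    by rewrite mul0r -leNgt marginal_ge0.
  have : sup A <= marginal f e S / marginal f e T.
    apply: ge_sup => // g [/andP [g0 _] gb].
    rewrite ler_pdivlMr //.
    case: (ltgtP g 0) => [|gp|->]; first by rewrite ltNge g0.
      by have := gb _ _ _ cl eT gp; rewrite mulrC ler_pdivlMr // mulrC.
    by rewrite mul0r marginal_ge0.
  by rewrite ler_pdivlMr // mulrC leNgt lt.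
- exact: le.
Qed.

Lemma pm_curvature_exists : exists alpha, is_pm_curvature Vs cap f alpha.
Proof.
pose A : classical_sets.set R :=
  fun a => 0 <= a <= 1 /\ pm_curvature_bound Vs cap f a.
have A1 : A 1.
  split; first by rewrite ler01 lexx.
  by move=> ? ? ? _ _; rewrite subrr mul0r marginal_ge0.
have An : classical_sets.nonempty A by exists 1.
have Alb : classical_sets.has_lbound A by exists 0 => a [/andP []].
have le a : A a -> inf A <= a by move=> Aa; exact: ge_inf.
exists (inf A); split=> [|S T e cl eT|a a01 ab].
- by rewrite le // andbT; apply: lb_le_inf => // a [/andP []].
- have := marginal_ge0 e S; rewrite le_eqVlt => /predU1P [<-|S0].
    by rewrite mulr0 marginal_ge0.
  rewrite -ler_pdivlMr // lerBlDr -lerBlDl.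
  apply: lb_le_inf => // a [_ /(_ _ _ _ cl eT)].
  by rewrite -ler_pdivlMr // lerBlDr -lerBlDl.
- exact: le.
Qed.

End Existence.

(* Main.v *)
Require Import Defs.
From HB Require Import structures.
From mathcomp Require Import all_boot all_order all_algebra.
From mathcomp Require Import reals sequences exp ring lra zify.

Set Implicit Arguments.
Unset Strict Implicit.
Unset Printing Implicit Defensive.

Import Order.TTheory GRing.Theory Num.Theory.
Local Open Scope ring_scope.

(** Extend the optimum to a set [T] with exactly [cap i] elements in each part, and
    turn [T] into the output one exchange at a time: after t iterations the hybrid
    solution is [S_t :|: O_t].  If the sample [R_t] meets [O_t], let [o] be an element
    of largest marginal in [R_t :&: O_t]; choosing [e] replaces [o] by [e] (or changes
    nothing when [e] is already in [O_t]), and by the two ratios the hybrid loses at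
    most [gamma'^-1 * x_o - (1 - alpha') * x_e], where [x_u] is the marginal of [u] at
    [S_t].  For the power selection rule, weighted AM-GM,
    [(a + 1) x_o x_u^a <= x_o^(a+1) + a x_u^(a+1)], summed over the sample, bounds the
    expected loss by the claimed multiple of the expected gain of [f (S_t)].

    The event is that every sample meets [O_t].  The probability of a miss at an
    iteration depends only on the part visited and on how many of its elements are
    already chosen, so the event has an explicit product probability and is
    compatible with the selection rule; if [q] of the [m] elements left in the part
    belong to [O_t], a sample of size [r] misses them with probability at most
    [(1 - q/m)^r <= exp (- q r / m) <= delta / b].  The number of queries is
    controlled by a harmonic sum over each part. *)

Lemma ler_weighted_amgm (R : realDomainType) (x y : R) (a : nat) :
  0 <= x -> 0 <= y -> a.+1%:R * (x * y ^+ a) <= x ^+ a.+1 + a%:R * y ^+ a.+1.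
Proof.
move=> x0 y0; elim: a => [|a IH]; first by rewrite !mul1r mul0r addr0 mulr1.
have rearrangement : 0 <= (x - y) * (x ^+ a.+1 - y ^+ a.+1).
  have [xy|/ltW yx] := lerP x y.
    by rewrite mulr_le0 // subr_le0 // lerXn2r.
  by rewrite mulr_ge0 // subr_ge0 // lerXn2r.
have := ler_wpM2l y0 IH; rewrite -![_.+1%:R]natr1.
move: rearrangement; rewrite ![_ ^+ a.+2]exprS ![_ ^+ a.+1]exprS.
by move: (x ^+ a) (y ^+ a) (a%:R : R) => u v b; nra.
Qed.

Lemma power_selection_le (R : realFieldType) (V : finType) (A : {set V})
    (x : V -> R) (o : V) (a : nat) (d N : R) :
  (forall u, 0 <= x u) -> 0 < N -> #|A|%:R <= d * a.+1%:R -> d * a.+1%:R <= N ->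
  x o * (\sum_(u in A) x u ^+ a - d * x o ^+ a)
    <= (1 - d / N) * \sum_(u in A) x u ^+ a.+1.
Proof.
move=> x0 N0 Ad dN; set W := \sum_(u in A) x u ^+ a; set Z := \sum_(u in A) _.
have Z0 : 0 <= Z by apply: sumr_ge0 => u _; rewrite exprn_ge0.
have amgm : a.+1%:R * (x o * W) <= #|A|%:R * x o ^+ a.+1 + a%:R * Z.
  rewrite [x o * W]mulr_sumr [a%:R * Z]mulr_sumr mulr_sumr.
  rewrite mulr_natl -sumr_const -big_split /=.
  by apply: ler_sum => u _; exact: ler_weighted_amgm.
have gap : (#|A|%:R - d * a.+1%:R) * x o ^+ a.+1 <= 0.
  by rewrite mulr_le0_ge0 ?exprn_ge0 // subr_le0.
have dNa : d / N * a.+1%:R * Z <= Z.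
  by rewrite ler_piMl // mulrAC ler_pdivrMr // mul1r.
rewrite -(@ler_pM2l _ a.+1%:R) ?ltr0n //.
move: gap amgm dNa; rewrite exprS -[a.+1%:R]natr1; lra.
Qed.

Lemma natr_ceil_itv (R : archiRealDomainType) (y : R) : -1 < y ->
  y <= `|Num.ceil y|%N%:R < y + 1.
Proof.
move=> y_gtN1; rewrite natr_absz ger0_norm ?ceil_ge0 // ceil_ge /=.
by have := ceilB1_lt y; rewrite intrD ltrBlDr.
Qed.

Lemma prodr_ge_1Bsum (R : realDomainType) (I : Type) (s : seq I) (P : pred I)
    (F G : I -> R) :
  (forall i, P i -> 0 <= F i <= 1) -> (forall i, P i -> 1 - G i <= F i) ->
  1 - \sum_(i <- s | P i) G i <= \prod_(i <- s | P i) F i.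
Proof.
move=> F01 GF; elim: s => [|i s IH]; first by rewrite !big_nil subr0.
have : 0 <= \prod_(j <- s | P j) F j <= 1.
  by rewrite prodr_ge0 ?prodr_ile1 // => j /F01 /andP [].
rewrite !big_cons; case: ifP => // Pi.
have := F01 i Pi; have := GF i Pi; move: IH.
by move: (F i) (G i) (\sum_(j <- s | _) _) (\prod_(j <- s | _) _) => a b c p; nra.
Qed.

Lemma ffact_expn_le (p m r : nat) : (p <= m)%N ->
  (p ^_ r * m ^ r <= m ^_ r * p ^ r)%N.
Proof.
move=> pm; elim: r => [|r IH]; first by rewrite !ffactn0 !expn0.
rewrite !ffactnSr !expnSr mulnACA [leqRHS]mulnACA leq_mul //.
by rewrite !mulnBl [(m * p)%N]mulnC leq_sub2l // leq_mul2l pm orbT.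
Qed.

Lemma bin_ratio_le (R : numFieldType) (p m r : nat) :
  (p <= m)%N -> (r <= m)%N -> 'C(p, r)%:R / 'C(m, r)%:R <= (p%:R / m%:R) ^+ r :> R.
Proof.
case: m => [|m] pm rm.
  by move: pm rm; rewrite !leqn0 => /eqP -> /eqP ->; rewrite !bin0 divr1.
rewrite expr_div_n ler_pdivlMr ?exprn_gt0 ?ltr0n // mulrAC.
rewrite ler_pdivrMr ?ltr0n ?bin_gt0 // -!natrX -!natrM ler_nat.
have := ffact_expn_le r pm; rewrite -!bin_ffact ![('C(_, _) * r`!)%N]mulnC -!mulnA.
by rewrite leq_pmul2l ?fact_gt0 // [(_ * 'C(m.+1, r))%N]mulnC.
Qed.

Lemma bin_ratio_le_expR (R : realType) (q m r : nat) :
  (q <= m)%N -> (r <= m)%N ->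
  'C(m - q, r)%:R / 'C(m, r)%:R <= expR (- (q%:R / m%:R * r%:R)) :> R.
Proof.
move=> qm rm; apply: le_trans (bin_ratio_le _ (leq_subr q m) rm) _.
rewrite -mulNr expRM_natr lerXn2r ?nnegrE ?expR_ge0 ?divr_ge0 //.
apply: le_trans (expR_ge1Dx _); have [->|m0] := eqVneq m 0%N.
  by rewrite sub0n !invr0 !mulr0 oppr0 addr0 ler01.
by rewrite natrB // mulrBl divff // pnatr_eq0.
Qed.

Lemma ln_ge_1BV (R : realType) (x : R) : 0 < x -> 1 - x^-1 <= ln x.
Proof.
move=> x0; have := @le_ln1Dx R (x^-1 - 1).
rewrite ltrBrDr addNr invr_gt0 => /(_ x0).
by rewrite [1 + _]addrC subrK lnV ?posrE // -lerN2 opprK opprB.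
Qed.

Lemma ln2_ge_half (R : realType) : 2^-1 <= ln 2 :> R.
Proof. by apply: le_trans (ln_ge_1BV _); lra. Qed.

Lemma harmonic_le_ln (R : realType) (n : nat) :
  \sum_(j < n) j.+1%:R^-1 <= 1 + ln n%:R :> R.
Proof.
case: n => [|n]; first by rewrite big_ord0 ln0 // addr0.
elim: n => [|n IH]; first by rewrite big_ord1 invr1 ln1 addr0.
have pos m : 0 < m.+1%:R :> R by rewrite ltr0n.
rewrite big_ord_recr /= -lerBrDr (le_trans IH) // -addrA lerD2l lerBrDr -lerBrDl.
rewrite -ln_div ?posrE // (le_trans _ (ln_ge_1BV _)) ?divr_gt0 //.
rewrite invf_div -[n.+1%:R](addrK 1) natr1 mulrBl divff ?gt_eqF // mul1r.
by rewrite opprB addrC subrK.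
Qed.

Lemma big_tuple_cons (R : Type) (idx : R) (op : Monoid.com_law idx) (A : finType)
    (n : nat) (P : pred (n.+1.-tuple A)) (F : n.+1.-tuple A -> R) :
  \big[op/idx]_(w | P w) F w =
  \big[op/idx]_(x : A) \big[op/idx]_(w : n.-tuple A | P [tuple of x :: w])
     F [tuple of x :: w].
Proof.
rewrite pair_big_dep /= (reindex (fun p : A * n.-tuple A =>
  [tuple of p.1 :: p.2])) //=.
exists (fun w => (thead w, [tuple of behead w])) => [[x w] _|w _] /=.
  by congr (_, _); apply: val_inj.
by rewrite [RHS]tuple_eta.
Qed.

Lemma big_tuple0 (R : Type) (idx : R) (op : Monoid.law idx) (A : finType)
    (F : 0.-tuple A -> R) :
  \big[op/idx]_w F w = F [tuple].
Proof. by apply: big_pred1 => w; apply/esym/eqP/tuple0. Qed.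

Section WeightedWalks.
Context {R : comPzSemiRingType} {X : finType} {S : Type}.
Variables (p : S -> X -> R) (next : S -> X -> S).
Implicit Types (s : S) (u : seq X).

Fixpoint walk_weight s u : R :=
  if u is x :: u' then p s x * walk_weight (next s x) u' else 1.

Lemma walk_weight_rcons s u x :
  walk_weight s (rcons u x) = walk_weight s u * p (foldl next s u) x.
Proof.
by elim: u s => [|y u IH] s /=; rewrite ?mul1r ?mulr1 // IH mulrA.
Qed.

Lemma walk_weight_cons_neq0 s x u : walk_weight s (x :: u) != 0 ->
  p s x != 0 /\ walk_weight (next s x) u != 0.
Proof.
by move=> nz; split; apply: contraNneq nz => /= ->; rewrite ?mul0r ?mulr0.
Qed.

Lemma sum_walk_prefix m n s u (P : pred (seq X)) : n = (size u + m)%N ->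
  \sum_(w : n.-tuple X | (take (size u) w == u) && P (drop (size u) w))
    walk_weight s w =
  walk_weight s u * \sum_(v : m.-tuple X | P v) walk_weight (foldl next s u) v.
Proof.
elim: u n s => [|x u IH] n s /= ->.
  by rewrite mul1r; apply: eq_bigl => w; rewrite take0 drop0 eqxx.
rewrite big_tuple_cons (bigD1 x) //= [X in _ + X]big1 ?addr0 => [|y /negPf yx].
  rewrite -mulrA -(IH (size u + m)%N) // mulr_sumr; apply: eq_bigl => w.
  by rewrite eqseq_cons eqxx.
by rewrite big_pred0 // => w; rewrite eqseq_cons yx.
Qed.

(* [reach n s]: the state [s] can be reached with [n] steps left. *)
Variable reach : nat -> S -> Prop.
Hypothesis reach_next :
  forall n s x, reach n.+1 s -> p s x != 0 -> reach n (next s x).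

Lemma walk_invariant m s u :
  reach (size u + m) s -> walk_weight s u != 0 -> reach m (foldl next s u).
Proof.
elim: u s => // x u IH s rs /walk_weight_cons_neq0 [px wu].
exact: IH (reach_next rs px) wu.
Qed.

Lemma walk_cost (cost : S -> X -> nat) (togo : S -> nat) n s (w : n.-tuple X) :
  (forall s, reach 0 s -> togo s = 0%N) ->
  (forall n s x, reach n.+1 s -> p s x != 0 ->
     togo s = (cost s x + togo (next s x))%N) ->
  reach n s -> walk_weight s w != 0 ->
  (\sum_(t < n) cost (foldl next s (take t w)) (tnth w t) = togo s)%N.
Proof.
move=> togo_end togo_step; elim: n s w => [|n IH] s w rs.
  by move=> _; rewrite big_ord0 togo_end.
case/tupleP: w => x w /walk_weight_cons_neq0 [px wx].
rewrite big_ord_recl (togo_step _ _ _ rs px).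
rewrite -(IH _ w) //; last exact: reach_next rs px.
by congr addn; apply: eq_bigr => t _; rewrite tnthS.
Qed.

Section Mass.
Variable mass : S -> R.
Hypothesis mass_end : forall s, reach 0 s -> mass s = 1.
Hypothesis mass_step :
  forall n s, reach n.+1 s -> \sum_x p s x * mass (next s x) = mass s.

Lemma sum_walk_weight n s :
  reach n s -> \sum_(w : n.-tuple X) walk_weight s w = mass s.
Proof.
elim: n s => [|n IH] s rs; first by rewrite big_tuple0 mass_end.
rewrite big_tuple_cons -(mass_step rs); apply: eq_bigr => x _ /=.
rewrite -mulr_sumr; have [->|px] := eqVneq (p s x) 0; first by rewrite !mul0r.
by rewrite (IH _ (reach_next rs px)).
Qed.

Lemma sum_walk_weight_head x0 n s (P : pred X) : reach n.+1 s ->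
  \sum_(w : n.+1.-tuple X | P (head x0 w)) walk_weight s w
    = \sum_(x | P x) p s x * mass (next s x).
Proof.
move=> rs; rewrite big_tuple_cons [RHS]big_mkcond; apply: eq_bigr => x _.
case: ifP => /= _; last by rewrite big_pred0_eq.
rewrite -mulr_sumr; have [->|px] := eqVneq (p s x) 0; first by rewrite !mul0r.
by rewrite (sum_walk_weight (reach_next rs px)).
Qed.

Lemma walk_conditional_step (q : S -> X -> R) (r : rel X) n s (w : n.-tuple X)
    (t : 'I_n) :
  (forall n s x, reach n.+1 s -> p s x * mass (next s x) =
     q s x * \sum_(y | r y x) p s y * mass (next s y)) ->
  reach n s ->
  \sum_(w' : n.-tuple X | take t.+1 w' == take t.+1 w) walk_weight s w' =
  q (foldl next s (take t w)) (tnth w t) *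
    \sum_(w' : n.-tuple X | (take t w' == take t w) && r (tnth w' t) (tnth w t))
      walk_weight s w'.
Proof.
move=> q_share rs; set x := tnth w t; set u := take t w; set st := foldl next s u.
have tn := ltn_ord t; pose m := (n - t.+1)%N.
have szu : size u = t by rewrite size_takel // size_tuple ltnW.
have nE : n = (size u + m.+1)%N by rewrite szu /m; lia.
have -> : take t.+1 w = rcons u x.
  by rewrite (take_nth x) ?size_tuple // -(tnth_nth x).
have -> : \sum_(w' : n.-tuple X | take t.+1 w' == rcons u x) walk_weight s w' =
    walk_weight s (rcons u x) * \sum_(v : m.-tuple X) walk_weight (next st x) v.
  rewrite -foldl_rcons -(@sum_walk_prefix m n s _ predT) ?size_rcons; last lia.
  by apply: eq_bigl => w'; rewrite szu andbT.
have -> : \sum_(w' : n.-tuple X | (take t w' == u) && r (tnth w' t) x)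
      walk_weight s w' =
    walk_weight s u * \sum_(v : m.+1.-tuple X | r (head x v) x) walk_weight st v.
  rewrite -(sum_walk_prefix s (fun v => r (head x v) x) nE) szu.
  by apply: eq_bigl => w'; rewrite -nth0 nth_drop addn0 -tnth_nth.
rewrite walk_weight_rcons -/st.
have [->|wu] := eqVneq (walk_weight s u) 0; first by rewrite !mul0r mulr0.
have rst : reach m.+1 st by apply: walk_invariant wu; rewrite -nE.
rewrite mulrCA -mulrA (sum_walk_weight_head x (fun y => r y x) rst).
rewrite -(q_share _ _ _ rst); congr (_ * _).
have [->|px] := eqVneq (p st x) 0; first by rewrite !mul0r.
by rewrite (sum_walk_weight (reach_next rst px)).
Qed.

End Mass.

End WeightedWalks.

Lemma walk_submartingale (R : numDomainType) (X : finType) (S : Type)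
    (p : S -> X -> R) (next : S -> X -> S) (reach : nat -> S -> Prop) (phi : S -> R)
    (n : nat) (s : S) :
  (forall n s x, reach n.+1 s -> p s x != 0 -> reach n (next s x)) ->
  (forall s x, 0 <= p s x) ->
  (forall n s, reach n.+1 s -> phi s <= \sum_x p s x * phi (next s x)) ->
  reach n s ->
  phi s <= \sum_(w : n.-tuple X) walk_weight p next s w * phi (foldl next s w).
Proof.
move=> reach_next p0 phi_step; elim: n s => [|n IH] s rs.
  by rewrite big_tuple0 /= mul1r.
apply: le_trans (phi_step _ _ rs) _; rewrite big_tuple_cons; apply: ler_sum => x _.
under eq_bigr do rewrite /= -mulrA.
rewrite -mulr_sumr; have [->|px] := eqVneq (p s x) 0; first by rewrite !mul0r.
by rewrite ler_wpM2l //; exact: IH (reach_next _ _ _ rs px).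
Qed.

Section RatioBounds.
Context {R : realType} {V : finType} {k : nat}.
Variables (Vs : 'I_k -> {set V}) (cap : 'I_k -> nat) (f : {set V} -> R).
Hypothesis f_mono : monotone f.

Lemma pm_dr_bound_le (g g' : R) : 0 < g' -> g' <= g ->
  pm_dr_bound Vs cap f g -> pm_dr_bound Vs cap f g'.
Proof.
move=> g'0 g_le dr S T e close eT _; have g0 := lt_le_trans g'0 g_le.
apply: le_trans (dr S T e close eT g0) _.
by rewrite ler_wpM2r ?marginal_ge0 // lef_pV2.
Qed.

Lemma pm_curvature_bound_ge (a a' : R) : a <= a' ->
  pm_curvature_bound Vs cap f a -> pm_curvature_bound Vs cap f a'.
Proof.
move=> a_le curv S T e close eT; apply: le_trans (curv S T e close eT).
by rewrite ler_wpM2r ?marginal_ge0 // lerD2l lerN2.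
Qed.

End RatioBounds.

Section Rounds.
Context {R : realType} {V : finType} {k : nat}.
Variables (Vs : 'I_k -> {set V}) (cap : 'I_k -> nat) (delta : R).
Hypothesis Vs_part : is_partition Vs.
Hypothesis cap_le : forall i, (1 <= cap i <= #|Vs i|)%N.
Implicit Types (S : {set V}) (e : V) (i j : 'I_k) (s : nat).

Lemma card_part_setU1 S i j e : e \in Vs i :\: S ->
  #|(e |: S) :&: Vs j| = ((j == i) + #|S :&: Vs j|)%N.
Proof.
move=> /setDP [eV eS]; have [_ disj _] := Vs_part; case: eqVneq => [->|ji].
  have -> : (e |: S) :&: Vs i = e |: (S :&: Vs i).
    by apply/setP => x; rewrite !inE; case: (eqVneq x e) => [->|//]; rewrite eV.
  by rewrite cardsU1 inE (negPf eS).
apply: eq_card => x; rewrite !inE.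
case: (eqVneq x e) => [->|//]; rewrite /= (negPf eS) /=.
by rewrite (disjointFl (disj _ _ ji) eV).
Qed.

Lemma feasible_extend S : feasible Vs cap S ->
  exists2 T : {set V}, S \subset T & forall i, #|T :&: Vs i| = cap i.
Proof.
move=> fS; pose P (T : {set V}) :=
  (S \subset T) && [forall i, #|T :&: Vs i| <= cap i]%N.
have PS : P S by rewrite /P subxx; apply/forallP.
case: (arg_maxnP (fun T : {set V} => #|T|) PS) => T /andP [ST /forallP fT] Tmax.
exists T => // i; apply/eqP; rewrite eqn_leq fT leqNgt; apply/negP => lt_cap.
have /set0Pn [e eT] : Vs i :\: T != set0.
  rewrite -card_gt0 cardsD subn_gt0 setIC (leq_trans lt_cap) //.
  by case/andP: (cap_le i).
have : P (e |: T).
  rewrite /P (subset_trans ST) ?subsetUr //; apply/forallP => j.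
  by rewrite (card_part_setU1 _ eT); case: eqVneq => [->|_]; last exact: fT.
by move/Tmax => /=; rewrite cardsU1; case/setDP: eT => _ ->; rewrite ltnn.
Qed.

Lemma card_ground : #|V| = (\sum_i #|Vs i|)%N.
Proof.
have [_ disj cover] := Vs_part; rewrite -cardsT -cover -sum1_card.
rewrite (partition_disjoint_bigcup _ (fun=> 1%N)) //.
by apply: eq_bigr => i _; rewrite sum1_card.
Qed.

Lemma cap_le_budget i : (cap i <= budget cap)%N.
Proof. by rewrite /budget (bigD1 i) //= leq_addr. Qed.

(* The rounds still to be played from [S] are the pairs [(i, s)]: the visit of part
   [i] at which [s] of its elements are already chosen. *)
Lemma big_rounds_full (T : Type) (idx : T) (op : Monoid.law idx)
    (F : 'I_k -> nat -> T) S : (forall i, #|S :&: Vs i| = cap i) ->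
  \big[op/idx]_j \big[op/idx]_(s < cap j | (#|S :&: Vs j| <= s)%N) F j s = idx.
Proof.
move=> full; apply: big1 => j _; apply: big1 => s.
by rewrite full leqNgt ltn_ord.
Qed.

Lemma big_rounds_setU1 (T : Type) (idx : T) (op : Monoid.com_law idx)
    (F : 'I_k -> nat -> T) S i e :
  e \in Vs i :\: S -> (#|S :&: Vs i| < cap i)%N ->
  \big[op/idx]_j \big[op/idx]_(s < cap j | (#|S :&: Vs j| <= s)%N) F j s =
  op (F i #|S :&: Vs i|)
     (\big[op/idx]_j \big[op/idx]_(s < cap j | (#|(e |: S) :&: Vs j| <= s)%N) F j s).
Proof.
move=> eS lti; rewrite (bigD1 i) //= [in RHS](bigD1 i) //=.
rewrite (bigD1 (Ordinal lti)) //= -[LHS]Monoid.mulmA; do 2!congr (op _ _).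
  apply: eq_bigl => s.
  by rewrite (card_part_setU1 _ eS) eqxx add1n ltn_neqAle andbC eq_sym.
by apply: eq_bigr => j ji; rewrite (card_part_setU1 _ eS) (negPf ji).
Qed.

Definition prescribed_size i s : R :=
  (#|Vs i|%:R - s%:R) / ((cap i)%:R - s%:R) * ln ((budget cap)%:R / delta).

Definition draw_size i s : nat :=
  if delta == 0 then (#|Vs i| - s)%N
  else minn (maxn 1 `|Num.ceil (prescribed_size i s)|%N) (#|Vs i| - s)%N.

Lemma sample_sizeE i S :
  sample_size Vs cap delta i S = draw_size i #|S :&: Vs i|.
Proof. by rewrite /sample_size /draw_size cardsD [Vs i :&: S]setIC. Qed.

Lemma draw_size_gt0 i s : (s < cap i)%N -> (0 < draw_size i s)%N.
Proof.
have [_ capV] := andP (cap_le i).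
by move=> s_cap; rewrite /draw_size; case: ifP => _; lia.
Qed.

Lemma draw_size_le i s : (draw_size i s <= #|Vs i| - s)%N.
Proof. by rewrite /draw_size; case: ifP => // _; rewrite geq_minr. Qed.

Lemma prescribed_size_le i s :
  (draw_size i s < #|Vs i| - s)%N -> prescribed_size i s <= (draw_size i s)%:R.
Proof.
rewrite /draw_size; case: ifP => _; first by rewrite ltnn.
rewrite gtn_min ltnn orbF => /ltnW /minn_idPl ->.
set y := prescribed_size i s; apply: le_trans (ceil_ge y) _.
apply: (@le_trans _ _ `|Num.ceil y|%:~R); first by rewrite ler_int ler_norm.
by rewrite -natr_absz ler_nat leq_maxr.
Qed.

Lemma draw_size_le_prescribed i s : 0 < delta -> delta <= 1 -> (s < cap i)%N ->
  (draw_size i s)%:R <= prescribed_size i s + 1.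
Proof.
move=> d0 d1 s_cap; have [_ capV] := andP (cap_le i).
have y0 : 0 <= prescribed_size i s.
  rewrite mulr_ge0 ?divr_ge0 ?subr_ge0 ?ler_nat ?ln_ge0 //; try lia.
  rewrite ler_pdivlMr // mul1r (le_trans d1) // ler1n.
  by have := cap_le_budget i; lia.
have /andP [_ /ltW ceil_le] := natr_ceil_itv (lt_le_trans (ltrN10 _) y0).
rewrite /draw_size gt_eqF //; set c := `|_|%N in ceil_le *.
have [c1|c1] := leqP c 1; last by rewrite (le_trans _ ceil_le) // ler_nat; lia.
by apply: (@le_trans _ _ 1%:R); [rewrite ler_nat; lia | rewrite lerDr].
Qed.

Definition hit_prob i s : R :=
  1 - 'C(#|Vs i| - cap i, draw_size i s)%:R / 'C(#|Vs i| - s, draw_size i s)%:R.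

Definition all_hit_prob S : R :=
  \prod_i \prod_(s < cap i | (#|S :&: Vs i| <= s)%N) hit_prob i s.

Lemma hit_prob_gt0 i s : (s < cap i)%N -> 0 < hit_prob i s.
Proof.
move=> s_cap; have [_ capV] := andP (cap_le i).
rewrite subr_gt0 ltr_pdivrMr ?ltr0n ?bin_gt0 ?draw_size_le //.
rewrite mul1r ltr_nat; have := draw_size_gt0 s_cap; have := draw_size_le i s.
case: (draw_size i s) => // r r_le _.
have -> : (#|Vs i| - s = (#|Vs i| - s).-1.+1)%N by lia.
rewrite binS -[ltnLHS]addn0 -addnS leq_add // ?bin_gt0; last by lia.
by apply: leq_bin2l; lia.
Qed.

Lemma hit_prob_le1 i s : hit_prob i s <= 1.
Proof. by rewrite lerBlDr lerDl divr_ge0. Qed.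

Lemma hit_prob_ge i s : 0 <= delta -> (s < cap i)%N ->
  1 - delta / (budget cap)%:R <= hit_prob i s.
Proof.
move=> d0 s_cap; have [_ capV] := andP (cap_le i); rewrite lerD2l lerN2.
have b0 : 0 < (budget cap)%:R :> R by rewrite ltr0n; have := cap_le_budget i; lia.
have := draw_size_le i s; rewrite leq_eqVlt => /predU1P [->|r_lt].
  by rewrite bin_small ?mul0r ?divr_ge0 //; lia.
have d_gt0 : 0 < delta.
  rewrite lt_neqAle d0 andbT; apply: contraTneq r_lt => dE.
  by rewrite /draw_size -dE eqxx ltnn.
have -> : (#|Vs i| - cap i = (#|Vs i| - s) - (cap i - s))%N by lia.
apply: le_trans (bin_ratio_le_expR _ _ (draw_size_le i s)) _; first by lia.
have -> : delta / (budget cap)%:R = expR (- ln ((budget cap)%:R / delta)).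
  by rewrite -lnV ?posrE ?divr_gt0 // invf_div lnK // posrE divr_gt0.
rewrite ler_expR lerN2; apply: le_trans (ler_wpM2l _ (prescribed_size_le r_lt)).
  rewrite /prescribed_size -!natrB; try lia.
  by rewrite !mulrA divfK ?divff ?mul1r // pnatr_eq0; lia.
by rewrite divr_ge0.
Qed.

Lemma all_hit_prob_gt0 S : 0 < all_hit_prob S.
Proof. by do 2!apply: prodr_gt0 => ? _; exact: hit_prob_gt0. Qed.

Lemma all_hit_prob_full S : (forall i, #|S :&: Vs i| = cap i) -> all_hit_prob S = 1.
Proof. exact: (big_rounds_full _ hit_prob). Qed.

Lemma all_hit_prob_setU1 S i e : e \in Vs i :\: S -> (#|S :&: Vs i| < cap i)%N ->
  all_hit_prob S = hit_prob i #|S :&: Vs i| * all_hit_prob (e |: S).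
Proof. exact: (big_rounds_setU1 _ hit_prob). Qed.

Lemma all_hit_prob_set0_ge : (0 < budget cap)%N -> 0 <= delta ->
  1 - delta <= all_hit_prob set0.
Proof.
move=> b0 d0; have hit01 i (s : 'I_(cap i)) : 0 <= hit_prob i s <= 1.
  by rewrite hit_prob_le1 ltW // hit_prob_gt0.
have -> : delta = \sum_i \sum_(s < cap i) delta / (budget cap)%:R.
  under eq_bigr do rewrite sumr_const card_ord.
  by rewrite sumrMnr -/(budget cap) -[RHS]mulr_natr divfK // pnatr_eq0 -lt0n.
apply: prodr_ge_1Bsum => i _.
  by rewrite prodr_ge0 ?prodr_ile1 // => s _; case/andP: (hit01 i s).
rewrite set0I cards0; apply: prodr_ge_1Bsum => s _ //.
exact: hit_prob_ge.
Qed.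

Definition queries_left S : nat :=
  (\sum_i \sum_(s < cap i | #|S :&: Vs i| <= s) (draw_size i s).+1)%N.

Lemma queries_left_full S :
  (forall i, #|S :&: Vs i| = cap i) -> queries_left S = 0%N.
Proof. exact: (big_rounds_full _ (fun i s => (draw_size i s).+1)). Qed.

Lemma queries_left_setU1 S i e : e \in Vs i :\: S -> (#|S :&: Vs i| < cap i)%N ->
  queries_left S = ((draw_size i #|S :&: Vs i|).+1 + queries_left (e |: S))%N.
Proof. exact: (big_rounds_setU1 _ (fun i s => (draw_size i s).+1)). Qed.

Lemma part_queries_le i : 0 < delta -> delta <= 1 ->
  (\sum_(s < cap i) (draw_size i s).+1)%:R <=
    2 * (cap i)%:R
    + #|Vs i|%:R * ln ((budget cap)%:R / delta) * (1 + ln (cap i)%:R) :> R.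
Proof.
move=> d0 d1; have [cap1 _] := andP (cap_le i); set L := ln (_ / delta).
have L0 : 0 <= L.
  rewrite ln_ge0 // ler_pdivlMr // mul1r (le_trans d1) // ler1n.
  exact: leq_trans cap1 (cap_le_budget i).
have round_le (s : 'I_(cap i)) :
    (draw_size i s).+1%:R <= 2 + #|Vs i|%:R * L * (cap i - s)%:R^-1.
  have s_cap := ltn_ord s; have := draw_size_le_prescribed d0 d1 s_cap.
  have : prescribed_size i s <= #|Vs i|%:R * L * (cap i - s)%:R^-1.
    rewrite /prescribed_size -/L mulrAC -[(cap i)%:R - _]natrB 1?ltnW //.
    by rewrite !ler_wpM2r ?invr_ge0 // gerBl.
  rewrite -natr1; lra.
have harmonic : \sum_(s < cap i) (cap i - s)%:R^-1 <= 1 + ln (cap i)%:R :> R.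
  rewrite (reindex_inj rev_ord_inj) /=; apply: le_trans (harmonic_le_ln R (cap i)).
  by apply: ler_sum => s _; rewrite subKn.
rewrite natr_sum; apply: (@le_trans _ _ (\sum_(s < cap i)
    (2 + #|Vs i|%:R * L * (cap i - s)%:R^-1))); first exact: ler_sum.
rewrite big_split /= sumr_const card_ord -[2 *+ _]mulr_natr lerD2l -mulr_sumr.
by rewrite ler_wpM2l // mulr_ge0.
Qed.

Lemma queries_left_set0_le : 0 < delta -> delta <= 1 -> (1 < budget cap)%N ->
  (queries_left set0)%:R <=
    11 * #|V|%:R * ln (budget cap)%:R * ln ((budget cap)%:R / delta) :> R.
Proof.
move=> d0 d1 b1; set L := ln (_ / delta); set B := ln _.
have b2 : 2 <= (budget cap)%:R :> R by rewrite (ler_nat R 2).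
have Bge : 2^-1 <= B by rewrite (le_trans (ln2_ge_half R)) // ler_ln ?posrE //; lra.
have BL : B <= L.
  rewrite ler_ln ?posrE ?divr_gt0 //; try lra.
  by rewrite ler_pdivlMr // ler_piMr.
have part_le i : (\sum_(s < cap i) (draw_size i s).+1)%:R <=
    2 * (cap i)%:R + #|Vs i|%:R * L * (1 + B).
  apply: le_trans (part_queries_le i d0 d1) _; rewrite -/L lerD2l ler_wpM2l //.
    by rewrite mulr_ge0 //; lra.
  have [cap1 _] := andP (cap_le i).
  by rewrite lerD2l ler_ln ?posrE ?ltr0n ?ler_nat ?cap_le_budget //; lia.
have -> : queries_left set0 = (\sum_i \sum_(s < cap i) (draw_size i s).+1)%N.
  by apply: eq_bigr => i _; rewrite set0I cards0.
rewrite natr_sum (le_trans (ler_sum _ (fun i _ => part_le i))) //.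
rewrite big_split /= -mulr_sumr -natr_sum -!mulr_suml -natr_sum -card_ground.
have bV : (budget cap)%:R <= #|V|%:R :> R.
  by rewrite ler_nat card_ground leq_sum // => i _; case/andP: (cap_le i).
have LB1 : 1 <= 4 * (L * B) by nra.
have VL : #|V|%:R * L <= #|V|%:R * L * (2 * B) by rewrite ler_peMr ?mulr_ge0 //; lra.
have V4 : #|V|%:R <= #|V|%:R * (4 * (L * B)) by rewrite ler_peMr.
rewrite -/(budget cap); lra.
Qed.

End Rounds.

Section Selection.
Context {R : realType} {V : finType}.
Variables (f : {set V} -> R) (gamma' alpha' : R).

Local Notation select := (select_prob f gamma' alpha').
Implicit Types (S O Rt : {set V}) (e o : V).

Definition damping : R := 1 - gamma' * (1 - alpha').

Definition mean_gain S Rt : R := \sum_e select S Rt e * marginal f e S.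

Lemma argmaxs_neq0 S Rt : Rt != set0 -> argmaxs f S Rt != set0.
Proof.
case/set0Pn => x xR; apply/set0Pn.
case: (@arg_maxP _ _ _ x (mem Rt) (fun u => marginal f u S) xR) => e eR emax.
by exists e; rewrite inE; apply/andP; split=> //; apply/forall_inP.
Qed.

Lemma select_supp S Rt e : select S Rt e != 0 -> e \in Rt.
Proof.
rewrite /select_prob; case: ifP => _; case: ifP => //; rewrite ?eqxx //.
by rewrite inE => /andP [].
Qed.

Lemma greedy_mean_gain_ge S Rt o :
  gamma' * (1 - alpha') = 1 -> o \in Rt -> marginal f o S <= mean_gain S Rt.
Proof.
move=> greedy oR; have Rn : Rt != set0 by apply/set0Pn; exists o.
rewrite -[leLHS]mul1r -(select_prob_sum1 f gamma' alpha' S Rn) mulr_suml.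
apply: ler_sum => e _; rewrite /select_prob greedy eqxx /=.
case: ifP; rewrite ?mul0r // inE => /andP [_ /forall_inP emax].
by rewrite ler_wpM2l ?invr_ge0 // emax.
Qed.

Hypothesis f_mono : monotone f.

Lemma select_ge0 S Rt e : 0 <= select S Rt e.
Proof.
have w0 u : 0 <= weight f gamma' alpha' S Rt u.
  by rewrite exprn_ge0 // marginal_ge0.
rewrite /select_prob; case: ifP => _; case: ifP => // _; first by rewrite invr_ge0.
by rewrite divr_ge0 // sumr_ge0.
Qed.

Lemma mean_gain_ge0 S Rt : 0 <= mean_gain S Rt.
Proof. by apply: sumr_ge0 => e _; rewrite mulr_ge0 ?select_ge0 ?marginal_ge0. Qed.

Hypothesis gamma_gt0 : 0 < gamma'.
Hypothesis gamma_le1 : gamma' <= 1.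
Hypothesis alpha_ge0 : 0 <= alpha'.
Hypothesis alpha_le1 : alpha' <= 1.

Lemma damping_ge0 : 0 <= damping.
Proof. by rewrite subr_ge0 mulr_ile1 ?subr_ge0 ?(ltW gamma_gt0) // gerBl. Qed.

Lemma damping_le1 : damping <= 1.
Proof. by rewrite gerBl mulr_ge0 ?subr_ge0 // ltW. Qed.

Lemma exponent_itv Rt : 0 < damping ->
  #|Rt|%:R <= damping * (exponent gamma' alpha' Rt).+1%:R <= #|Rt|%:R + 2.
Proof.
move=> d0; have d1 := damping_le1; set y : R := (#|Rt|%:R + 1) / damping.
have yE : #|Rt|%:R + 1 = damping * y by rewrite mulrC divfK // gt_eqF.
have y0 : 0 < y by rewrite divr_gt0 // ltr_wpDl.
have /andP [y_le lt_y] := natr_ceil_itv (lt_trans (ltrN10 _) y0).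
rewrite /exponent prednK; last by rewrite absz_gt0 gt_eqF // ceil_gt0.
rewrite -/damping -/y; set c : R := `|_|%N%:R in y_le lt_y *.
have := ler_wpM2l (ltW d0) y_le; have := ler_wpM2l (ltW d0) (ltW lt_y); lra.
Qed.

Lemma power_mean_gain_ge S Rt o (N : R) : 0 < damping ->
  \sum_(u in Rt) weight f gamma' alpha' S Rt u != 0 ->
  o \in Rt -> #|Rt|%:R + 2 <= N ->
  marginal f o S * (1 - damping * select S Rt o)
    <= (1 - damping / N) * mean_gain S Rt.
Proof.
move=> d0 W0 oR RN; set a := exponent gamma' alpha' Rt.
set W := \sum_(u in Rt) _ in W0.
have x0 u : 0 <= marginal f u S by exact: marginal_ge0.
have WE : W = \sum_(u in Rt) marginal f u S ^+ a by [].
have W_gt0 : 0 < W.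
  by rewrite lt_neqAle eq_sym W0 WE sumr_ge0 // => u _; rewrite exprn_ge0.
have not_greedy : gamma' * (1 - alpha') < 1 by rewrite -subr_gt0.
have selE e : select S Rt e = if e \in Rt then marginal f e S ^+ a / W else 0.
  by rewrite /select_prob (negPf W0) orbF lt_eqF.
have gainE : mean_gain S Rt = (\sum_(e in Rt) marginal f e S ^+ a.+1) / W.
  rewrite mulr_suml big_mkcond; apply: eq_bigr => e _; rewrite selE.
  by case: ifP => _; rewrite ?mul0r // mulrAC -exprSr.
have N0 : 0 < N by apply: lt_le_trans RN; rewrite ltr_wpDl.
have /andP [ge_R le_R] := exponent_itv Rt d0.
rewrite gainE selE oR [leRHS]mulrA ler_pdivlMr // -[leLHS]mulrA.
rewrite [_ * W]mulrBl mul1r [damping * _]mulrA divfK ?gt_eqF //.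
apply: (power_selection_le (x := fun u => marginal f u S)) => //.
exact: le_trans le_R RN.
Qed.

Lemma mean_gain_ge S Rt o (N : R) : o \in Rt -> #|Rt|%:R + 2 <= N ->
  marginal f o S * (1 - damping * select S Rt o)
    <= (1 - damping / N) * mean_gain S Rt.
Proof.
move=> oR RN; have [greedy|not_greedy] := eqVneq (gamma' * (1 - alpha')) 1.
  rewrite /damping greedy subrr !mul0r subr0 mulr1 mul1r.
  exact: greedy_mean_gain_ge.
have d_gt0 : 0 < damping.
  by rewrite lt_neqAle damping_ge0 eq_sym subr_eq0 eq_sym not_greedy.
have [W0|W0] := eqVneq (\sum_(u in Rt) weight f gamma' alpha' S Rt u) 0; last first.
  exact: power_mean_gain_ge.
have xo0 : marginal f o S = 0.
  have w0 u : u \in Rt -> 0 <= weight f gamma' alpha' S Rt u.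
    by rewrite exprn_ge0 // marginal_ge0.
  by have /eqP := psumr_eq0P w0 W0 oR; rewrite expf_eq0 => /andP [_ /eqP].
rewrite xo0 mul0r mulr_ge0 ?mean_gain_ge0 // subr_ge0 ler_pdivrMr ?mul1r.
  by rewrite (le_trans damping_le1) // (le_trans _ RN) // ler_wpDl // ler1n.
by apply: lt_le_trans RN; rewrite ltr_wpDl.
Qed.

End Selection.

Section Exchange.
Context {R : realType} {V : finType} {k : nat}.
Variables (Vs : 'I_k -> {set V}) (cap : 'I_k -> nat) (f : {set V} -> R).
Variables (gamma' alpha' : R).

Local Notation select := (select_prob f gamma' alpha').
Implicit Types (S O Rt : {set V}) (e o : V).

Definition exchange S O Rt e : V :=
  if e \in O then e else odflt e [pick o in argmaxs f S (Rt :&: O)].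

Lemma exchange_in S O Rt e : Rt :&: O != set0 -> e \in Rt ->
  exchange S O Rt e \in Rt :&: O.
Proof.
move=> hit eR; rewrite /exchange; case: ifP => [eO|_]; first by rewrite inE eR.
case: pickP => [o|none]; first by rewrite inE => /andP [].
by case/set0Pn: (argmaxs_neq0 f S hit) => o; rewrite none.
Qed.

Lemma exchange_disjoint S O Rt e : [disjoint O & S] ->
  [disjoint O :\ exchange S O Rt e & e |: S].
Proof.
move=> dis; rewrite -setI_eq0; apply/eqP/setP => x; rewrite !inE.
have [->|_] /= := eqVneq x e.
  by rewrite andbT /exchange; case: (e \in O); rewrite ?eqxx ?andbF.
by apply/negP => /andP [/andP [_ xO] xS]; rewrite (disjointFr dis xO) in xS.
Qed.

Lemma setU_exchange_mem S O Rt e : e \in O ->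
  (e |: S) :|: (O :\ exchange S O Rt e) = S :|: O.
Proof.
move=> eO; rewrite /exchange eO; apply/setP => x; rewrite !inE.
by case: eqVneq => [->|//]; rewrite eO orbT.
Qed.

Hypothesis f_mono : monotone f.
Hypothesis gamma_gt0 : 0 < gamma'.
Hypothesis gamma_le1 : gamma' <= 1.
Hypothesis alpha_ge0 : 0 <= alpha'.
Hypothesis alpha_le1 : alpha' <= 1.
Hypothesis dr_bound : pm_dr_bound Vs cap f gamma'.
Hypothesis curv_bound : pm_curvature_bound Vs cap f alpha'.

(* Both the old and the new hybrid solution extend W = S :|: O :\ o' by one element;
   the two ratios compare the marginals at W with those at S. *)
Lemma exchange_loss_le S O Rt o e :
  [disjoint O & S] -> (forall i, #|O :&: Vs i| <= cap i)%N -> [disjoint Rt & S] ->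
  o \in argmaxs f S (Rt :&: O) -> e \in Rt ->
  f (S :|: O) - f ((e |: S) :|: (O :\ exchange S O Rt e))
    <= gamma'^-1 * marginal f o S - (1 - alpha') * marginal f e S.
Proof.
move=> disO capO disR; rewrite inE => /andP [oRO /forall_inP omax] eR.
have g1 : 1 <= gamma'^-1 by rewrite invf_ge1.
have x0 u : 0 <= marginal f u S by exact: marginal_ge0.
have [eO|eO] := boolP (e \in O).
  rewrite setU_exchange_mem // subrr subr_ge0.
  apply: (@le_trans _ _ (marginal f e S)); first by rewrite ler_piMl // gerBl.
  apply: le_trans (omax e _) _; first by rewrite inE eR.
  by rewrite ler_peMl.
have hit : Rt :&: O != set0 by apply/set0Pn; exists o.
have := exchange_in S hit eR; set o' := exchange _ _ _ _ => o'RO.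
have [_ o'O] := setIP o'RO; pose W := S :|: (O :\ o').
have oldE : S :|: O = o' |: W.
  by apply/setP => x; rewrite !inE; case: eqVneq => [->|//]; rewrite o'O orbT.
have o'W : o' \notin W by rewrite !inE eqxx orbF (disjointFr disO o'O).
have eW : e \notin W by rewrite !inE (disjointFr disR eR) (negPf eO) andbF.
have close : pm_close Vs cap S W.
  split=> [|j]; first exact: subsetUl.
  apply: leq_trans (capO j); apply: subset_leq_card; apply: setSI.
  by rewrite subDset setUS // subsetDl.
have := dr_bound close o'W gamma_gt0; have := curv_bound close eW.
have : gamma'^-1 * marginal f o' S <= gamma'^-1 * marginal f o S.
  by rewrite ler_wpM2l ?omax // ltW // invr_gt0.
rewrite oldE -setUA /marginal -/W; lra.
Qed.

Definition loss_ratio (N : R) : R := (gamma'^-1 + alpha' - 1) * (1 - N^-1).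

Lemma mean_exchange_loss_le S O Rt (N : R) :
  [disjoint O & S] -> (forall i, #|O :&: Vs i| <= cap i)%N -> [disjoint Rt & S] ->
  Rt :&: O != set0 -> #|Rt|%:R + 2 <= N ->
  \sum_e select S Rt e *
      (f (S :|: O) - f ((e |: S) :|: (O :\ exchange S O Rt e)))
    <= loss_ratio N * mean_gain f gamma' alpha' S Rt.
Proof.
move=> disO capO disR hit RN; have [o omax] := set0Pn _ (argmaxs_neq0 f S hit).
have /setIP [oR oO] : o \in Rt :&: O by move: omax; rewrite inE => /andP [].
pose p e := select S Rt e; pose x e := marginal f e S.
set M := mean_gain _ _ _ _ _.
have Rn : Rt != set0 by apply/set0Pn; exists o.
have p1 : \sum_(e | e != o) p e = 1 - p o.
  rewrite -(select_prob_sum1 f gamma' alpha' S Rn) [in RHS](bigD1 o) //=.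
  by rewrite [RHS]addrC addKr.
have px : \sum_(e | e != o) p e * x e = M - p o * x o.
  by rewrite /M /mean_gain [in RHS](bigD1 o) //= [RHS]addrC addKr.
have gain : gamma'^-1 * (x o * (1 - damping gamma' alpha' * p o))
    <= gamma'^-1 * ((1 - damping gamma' alpha' / N) * M).
  by rewrite ler_wpM2l ?invr_ge0 ?(ltW gamma_gt0) //; exact: mean_gain_ge.
rewrite (bigD1 o) //= setU_exchange_mem // subrr mulr0 add0r.
apply: (@le_trans _ _ (\sum_(e | e != o) p e *
    (gamma'^-1 * x o - (1 - alpha') * x e))).
  apply: ler_sum => e _; have [pe0|pe0] := eqVneq (p e) 0.
    by rewrite /p in pe0 *; rewrite pe0 !mul0r.
  rewrite ler_wpM2l ?select_ge0 //; apply: exchange_loss_le => //.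
  exact: select_supp pe0.
under eq_bigr do rewrite mulrBr [p _ * ((1 - alpha') * _)]mulrCA.
rewrite sumrB -mulr_suml -mulr_sumr p1 px.
have -> : loss_ratio N * M =
    gamma'^-1 * ((1 - damping gamma' alpha' / N) * M) - (1 - alpha') * M.
  by rewrite /loss_ratio /damping; move: (N^-1) => z; field; rewrite gt_eqF.
have -> : (1 - p o) * (gamma'^-1 * x o) - (1 - alpha') * (M - p o * x o) =
    gamma'^-1 * (x o * (1 - damping gamma' alpha' * p o)) - (1 - alpha') * M.
  by rewrite /damping; field; rewrite gt_eqF.
by rewrite lerD2r.
Qed.

Lemma hybrid_potential_le S O Rt (N : R) :
  [disjoint O & S] -> (forall i, #|O :&: Vs i| <= cap i)%N -> [disjoint Rt & S] ->
  Rt :&: O != set0 -> #|Rt|%:R + 2 <= N ->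
  f (S :|: O) + loss_ratio N * f S <=
  \sum_e select S Rt e *
    (f ((e |: S) :|: (O :\ exchange S O Rt e)) + loss_ratio N * f (e |: S)).
Proof.
move=> disO capO disR hit RN.
have Rn : Rt != set0 by apply: contraNneq hit => ->; rewrite set0I.
rewrite -subr_ge0; set gap := (X in 0 <= X).
suff -> : gap = loss_ratio N * mean_gain f gamma' alpha' S Rt - \sum_e
    select S Rt e * (f (S :|: O) - f ((e |: S) :|: (O :\ exchange S O Rt e))).
  by rewrite subr_ge0 mean_exchange_loss_le.
rewrite /gap -[X in _ - X]mul1r -(select_prob_sum1 f gamma' alpha' S Rn) mulr_suml.
rewrite mulr_sumr -!sumrB; apply: eq_bigr => e _; rewrite /marginal; ring.
Qed.

End Exchange.

Section HybridWalk.
Context {R : realType} {V : finType} {k : nat}.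
Variables (Vs : 'I_k -> {set V}) (cap : 'I_k -> nat) (f : {set V} -> R).
Variables (gamma' alpha' delta : R).
Hypothesis Vs_part : is_partition Vs.
Hypothesis cap_le : forall i, (1 <= cap i <= #|Vs i|)%N.

Local Notation state := (@state V k).
Local Notation iteration := ({set V} * V)%type.
Local Notation sample := (sample_prob Vs cap delta).
Local Notation select := (select_prob f gamma' alpha').
Local Notation step := (step_prob Vs cap f gamma' alpha' delta).
Implicit Types (st : state) (S O T Rt : {set V}) (e : V) (i j : 'I_k).
Implicit Types (h : state * {set V}) (x : iteration).

Definition loop_next st x : state := next_state Vs cap st x.2.

Lemma traj_probE (w : trajectory cap) :
  traj_prob Vs f gamma' alpha' delta w = walk_weight step loop_next init_state w.
Proof.
by rewrite /traj_prob; elim: (tval w) init_state => //= x u IH st; rewrite IH.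
Qed.

Definition loop_inv st : Prop :=
  [/\ active st = [set i | (#|cur st :&: Vs i| < cap i)%N],
      uniq (queue st), {subset queue st <= active st}
    & forall i, (#|cur st :&: Vs i| <= cap i)%N].

Definition steps_left st : nat := (\sum_i (cap i - #|cur st :&: Vs i|))%N.

Definition in_loop n st : Prop := loop_inv st /\ steps_left st = n.

Lemma in_loop_init : in_loop (budget cap) init_state.
Proof. by split; [exact: inv_init | exact: left_init]. Qed.

Lemma in_loop_pending n st : in_loop n.+1 st ->
  exists i q, pending st = i :: q /\ (#|cur st :&: Vs i| < cap i)%N.
Proof.
move=> [inv left]; have := pending_nil inv.
rewrite -/(steps_left st) left => /(_ isT); have [_ sub] := pendingP inv.
have [activeE _ _ _] := inv; case pend : (pending st) => [//|i q] _.
exists i, q; split=> //.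
by have := sub i; rewrite pend mem_head activeE inE; exact.
Qed.

Lemma in_loop_end st : in_loop 0 st -> forall i, #|cur st :&: Vs i| = cap i.
Proof.
move=> [[_ _ _ cur_le] /eqP]; rewrite sum_nat_eq0 => /forallP left i.
by apply/eqP; rewrite eqn_leq cur_le -subn_eq0; exact: left.
Qed.

Lemma cur_next st i q x : pending st = i :: q -> cur (loop_next st x) = x.2 |: cur st.
Proof. by rewrite /loop_next /next_state => ->. Qed.

Lemma in_loop_next n st x :
  in_loop n.+1 st -> step st x != 0 -> in_loop n (loop_next st x).
Proof.
move=> inl nz; have [i [q [pend _]]] := in_loop_pending inl; have [inv left] := inl.
have [sub _ eR] := step_prob_supp pend nz.
have [inv' left'] := inv_next Vs_part inv pend (subsetP sub _ eR).
by split=> //; apply: succn_inj; rewrite -left; symmetry.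
Qed.

Lemma queries_left_end st : in_loop 0 st -> queries_left Vs cap delta (cur st) = 0%N.
Proof. by move=> /in_loop_end /queries_left_full. Qed.

Lemma queries_left_next n st x : in_loop n.+1 st -> step st x != 0 ->
  queries_left Vs cap delta (cur st) =
  (size (iter_queries (cur st) x.1)
     + queries_left Vs cap delta (cur (loop_next st x)))%N.
Proof.
move=> inl nz; have [i [q [pend lt_cap]]] := in_loop_pending inl.
have [sub sizeR eR] := step_prob_supp pend nz; rewrite (cur_next _ pend).
rewrite (queries_left_setU1 _ Vs_part (subsetP sub _ eR) lt_cap).
by rewrite /= size_map -cardE sizeR sample_sizeE.
Qed.

Lemma num_queriesE (w : trajectory cap) :
  traj_prob Vs f gamma' alpha' delta w != 0 ->
  num_queries Vs w = queries_left Vs cap delta set0.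
Proof.
rewrite traj_probE.
exact: (walk_cost in_loop_next queries_left_end queries_left_next in_loop_init).
Qed.

(* A hybrid state [(st, O)] stands for the hybrid solution [cur st :|: O].  The walk
   is killed when a sample misses [O], so its weight is not a probability. *)
Definition hybrid_next h x : state * {set V} :=
  (loop_next h.1 x, h.2 :\ exchange f (cur h.1) h.2 x.1 x.2).

Definition hit_sample_prob i S O Rt : R :=
  if Rt :&: O != set0 then sample i S Rt else 0.

Definition hybrid_step h x : R :=
  if pending h.1 is i :: _
  then hit_sample_prob i (cur h.1) h.2 x.1 * select (cur h.1) x.1 x.2
  else 0.

Local Notation hybrid_weight := (walk_weight hybrid_step hybrid_next).

Definition in_hybrid n h : Prop :=
  [/\ in_loop n h.1, [disjoint h.2 & cur h.1]
    & forall i, (#|h.2 :&: Vs i| + #|cur h.1 :&: Vs i| = cap i)%N].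

Lemma in_hybrid_pending n h : in_hybrid n.+1 h ->
  exists i q, pending h.1 = i :: q /\ (#|cur h.1 :&: Vs i| < cap i)%N.
Proof. by case=> /in_loop_pending. Qed.

Lemma in_hybrid_init T : (forall i, #|T :&: Vs i| = cap i) ->
  in_hybrid (budget cap) (init_state, T).
Proof.
move=> capT; split=> [||i]; first exact: in_loop_init.
  by rewrite -setI_eq0 setI0.
by rewrite capT set0I cards0 addn0.
Qed.

Lemma hybrid_step_supp h x : hybrid_step h x != 0 ->
  hybrid_step h x = step h.1 x /\ x.1 :&: h.2 != set0.
Proof.
rewrite /hybrid_step /step_prob /hit_sample_prob; case: (pending h.1) => [|i q].
  by rewrite eqxx.
by case: ifP => // _; rewrite mul0r eqxx.
Qed.

Lemma in_hybrid_next n h x :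
  in_hybrid n.+1 h -> hybrid_step h x != 0 -> in_hybrid n (hybrid_next h x).
Proof.
move=> inh nz; have [i [q [pend _]]] := in_hybrid_pending inh.
have [inl dis fill] := inh; have [stepE hit] := hybrid_step_supp nz.
rewrite stepE in nz; have [sub _ eR] := step_prob_supp pend nz.
split; first exact: in_loop_next inl nz.
  by rewrite (cur_next _ pend); exact: exchange_disjoint.
move=> j; rewrite (cur_next _ pend) (card_part_setU1 Vs_part _ (subsetP sub _ eR)).
have /setIP [oR oO] := exchange_in f (cur h.1) hit eR.
have /setDP [oV _] := subsetP sub _ oR.
set o := exchange _ _ _ _ _ in oR oO oV *; rewrite -fill addnA; congr (_ + _)%N.
rewrite setIDAC /= -/o; case: eqVneq => [->|ji].
  by rewrite [RHS](cardsD1 o) inE oO oV addnC.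
rewrite addn0 [RHS](cardsD1 o) inE; have [_ disj _] := Vs_part.
by rewrite (disjointFl (disj _ _ ji) oV) andbF.
Qed.

Lemma in_hybrid_le n h : in_hybrid n h -> forall i, (#|h.2 :&: Vs i| <= cap i)%N.
Proof. by move=> [_ _ fill] i; rewrite -fill leq_addr. Qed.

Lemma in_hybrid_end h : in_hybrid 0 h -> h.2 = set0.
Proof.
move=> [inl _ fill]; apply/setP => x; rewrite inE; apply/negP => xO.
have [_ _ cover] := Vs_part; have : x \in [set: V] by rewrite inE.
rewrite -cover => /bigcupP [i _ xV].
have /eqP := fill i; rewrite (in_loop_end inl) -[X in _ == X]add0n eqn_add2r.
by rewrite cards_eq0 => /eqP /setP /(_ x); rewrite !inE xO xV.
Qed.

Lemma sum_hit_sample_prob n h i : in_hybrid n h ->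
  \sum_Rt hit_sample_prob i (cur h.1) h.2 Rt
    = hit_prob Vs cap delta i #|cur h.1 :&: Vs i|.
Proof.
move=> [_ dis fill]; apply/eqP; rewrite /hit_prob eq_sym subr_eq -big_mkcond /=.
rewrite -[X in X == _](sample_prob_sum1 Vs cap delta i (cur h.1)).
rewrite (bigID (fun Rt : {set V} => Rt :&: h.2 != set0)) /=.
apply/eqP; congr (_ + _).
rewrite /sample_prob -big_mkcondr /= sumr_const -[LHS]mulr_natl sample_sizeE.
have cardD : #|Vs i :\: cur h.1| = (#|Vs i| - #|cur h.1 :&: Vs i|)%N.
  by rewrite cardsD [Vs i :&: _]setIC.
rewrite cardD; congr (_%:R * _).
have -> : (#|Vs i| - cap i)%N = #|(Vs i :\: cur h.1) :\: h.2|.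
  rewrite cardsD cardD -subnDA -fill addnC; congr (_ - (_ + _))%N.
  apply: eq_card => x; rewrite !inE andbC; have [xO|_] := boolP (x \in h.2).
    by rewrite (disjointFr dis xO).
  by rewrite !andbF.
rewrite -cards_draws; apply: eq_card => A; rewrite [RHS]inE unfold_in negbK.
by rewrite [A \subset _ :\: h.2]subsetD -setI_eq0 [in RHS]andbAC andbC.
Qed.

Lemma hit_sample_prob_supp i S O Rt : hit_sample_prob i S O Rt != 0 ->
  Rt :&: O != set0 /\ Rt \subset Vs i :\: S.
Proof.
rewrite /hit_sample_prob /sample_prob; case: ifP => // hit; last by rewrite eqxx.
by case: ifP => [/andP [-> _]|]; rewrite ?eqxx.
Qed.

Lemma sum_hybrid_step h i q (P : pred {set V}) (F : iteration -> R) :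
  pending h.1 = i :: q ->
  \sum_(x | P x.1) hybrid_step h x * F x =
  \sum_(Rt | P Rt) hit_sample_prob i (cur h.1) h.2 Rt
    * \sum_e select (cur h.1) Rt e * F (Rt, e).
Proof.
move=> pend; under [RHS]eq_bigr => Rt _ do rewrite mulr_sumr.
rewrite pair_big_dep /=; apply: eq_big => [[Rt e]|[Rt e] _] /=; first by rewrite andbT.
by rewrite /hybrid_step pend mulrA.
Qed.

Lemma sum_hybrid_step_const h i q (P : pred {set V}) (a : R) :
  pending h.1 = i :: q ->
  \sum_(x | P x.1) hybrid_step h x * a =
  \sum_(Rt | P Rt) hit_sample_prob i (cur h.1) h.2 Rt * a.
Proof.
move=> pend; rewrite (sum_hybrid_step _ (fun=> a) pend); apply: eq_bigr => Rt _.
have [->|nz] := eqVneq (hit_sample_prob i (cur h.1) h.2 Rt) 0; first by rewrite !mul0r.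
have [hit _] := hit_sample_prob_supp nz.
rewrite -mulr_suml select_prob_sum1 ?mul1r //.
by apply: contraNneq hit => ->; rewrite set0I.
Qed.

Definition survival h : R := all_hit_prob Vs cap delta (cur h.1).

(* The chance of surviving the later steps does not depend on [x], hence conditioning
   on survival leaves the law of [e_t] unchanged. *)
Lemma survival_next n h i q x : in_hybrid n.+1 h -> pending h.1 = i :: q ->
  (#|cur h.1 :&: Vs i| < cap i)%N ->
  hybrid_step h x * survival (hybrid_next h x) =
  hybrid_step h x * (survival h / hit_prob Vs cap delta i #|cur h.1 :&: Vs i|).
Proof.
move=> inh pend lt_cap; have [->|nz] := eqVneq (hybrid_step h x) 0.
  by rewrite !mul0r.
have [stepE _] := hybrid_step_supp nz; rewrite stepE in nz.
have [sub _ eR] := step_prob_supp pend nz.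
rewrite /survival (cur_next _ pend).
rewrite (all_hit_prob_setU1 _ Vs_part (subsetP sub _ eR) lt_cap) mulrAC divff ?mul1r //.
by rewrite gt_eqF // hit_prob_gt0.
Qed.

Lemma survival_step n h : in_hybrid n.+1 h ->
  \sum_x hybrid_step h x * survival (hybrid_next h x) = survival h.
Proof.
move=> inh; have [i [q [pend lt_cap]]] := in_hybrid_pending inh.
under eq_bigr do rewrite (survival_next _ inh pend lt_cap).
rewrite (sum_hybrid_step_const predT _ pend) -mulr_suml (sum_hit_sample_prob i inh).
by rewrite mulrC divfK // gt_eqF // hit_prob_gt0.
Qed.

Lemma survival_end h : in_hybrid 0 h -> survival h = 1.
Proof. by move=> [inl _ _]; apply/all_hit_prob_full/in_loop_end. Qed.

Lemma survival_share n h x : in_hybrid n.+1 h ->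
  hybrid_step h x * survival (hybrid_next h x) =
  select (cur h.1) x.1 x.2 *
    \sum_(y | y.1 == x.1) hybrid_step h y * survival (hybrid_next h y).
Proof.
move=> inh; have [i [q [pend lt_cap]]] := in_hybrid_pending inh.
rewrite (survival_next _ inh pend lt_cap).
under eq_bigr do rewrite (survival_next _ inh pend lt_cap).
rewrite (sum_hybrid_step_const (fun Rt => Rt == x.1) _ pend) big_pred1_eq.
by rewrite /hybrid_step pend -mulrA mulrCA.
Qed.

Definition survivors O : {set trajectory cap} :=
  [set w : trajectory cap | hybrid_weight (init_state, O) w != 0].

Lemma hybrid_weightE O (w : trajectory cap) :
  hybrid_weight (init_state, O) w =
  if w \in survivors O then traj_prob Vs f gamma' alpha' delta w else 0.
Proof.
rewrite inE; case: eqVneq => // nz; rewrite traj_probE; move: nz.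
elim: (tval w) init_state O => // x u IH st O xu_nz.
have [x_nz u_nz] := walk_weight_cons_neq0 xu_nz.
by have [stepE _] := hybrid_step_supp x_nz; rewrite /= stepE IH.
Qed.

Lemma Pr_survivors O (P : pred (trajectory cap)) :
  Pr Vs f gamma' alpha' delta [set w in survivors O | P w] =
  \sum_(w : trajectory cap | P w) hybrid_weight (init_state, O) w.
Proof.
rewrite (eq_bigr _ (fun w _ => hybrid_weightE O w)) -big_mkcondr /=.
by apply: eq_bigl => w; rewrite !inE andbC.
Qed.

Lemma Pr_survivorsE O : in_hybrid (budget cap) (init_state, O) ->
  Pr Vs f gamma' alpha' delta (survivors O) = all_hit_prob Vs cap delta set0.
Proof.
move=> inh.
rewrite -[RHS](sum_walk_weight in_hybrid_next survival_end survival_step inh).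
rewrite -(Pr_survivors O predT); congr (Pr _ _ _ _ _ _).
by apply/setP => w; rewrite !inE andbT.
Qed.

Lemma foldl_hybrid_next O (u : seq iteration) :
  (foldl hybrid_next (init_state, O) u).1 = run Vs cap u.
Proof. by rewrite /run; elim: u init_state O => //= x u IH st O; rewrite IH. Qed.

Lemma sampling_event_survivors O : in_hybrid (budget cap) (init_state, O) ->
  sampling_event Vs f gamma' alpha' delta (survivors O).
Proof.
move=> inh t w; rewrite !Pr_survivors.
have := walk_conditional_step (q := fun h x => select (cur h.1) x.1 x.2)
  (r := fun y x => y.1 == x.1) in_hybrid_next survival_end survival_step w t
  survival_share inh.
by rewrite foldl_hybrid_next.
Qed.

Hypothesis f_mono : monotone f.
Hypothesis gamma_gt0 : 0 < gamma'.
Hypothesis gamma_le1 : gamma' <= 1.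
Hypothesis alpha_ge0 : 0 <= alpha'.
Hypothesis alpha_le1 : alpha' <= 1.
Hypothesis dr_bound : pm_dr_bound Vs cap f gamma'.
Hypothesis curv_bound : pm_curvature_bound Vs cap f alpha'.

Lemma sample_prob_ge0 i S Rt : 0 <= sample i S Rt.
Proof. by rewrite /sample_prob; case: ifP => // _; rewrite invr_ge0. Qed.

Lemma hit_sample_prob_ge0 i S O Rt : 0 <= hit_sample_prob i S O Rt.
Proof. by rewrite /hit_sample_prob; case: ifP => // _; exact: sample_prob_ge0. Qed.

Lemma hybrid_step_ge0 h x : 0 <= hybrid_step h x.
Proof.
rewrite /hybrid_step; case: (pending h.1) => // i _.
by rewrite mulr_ge0 ?hit_sample_prob_ge0 ?select_ge0.
Qed.

Let ratio : R := loss_ratio gamma' alpha' ((max_part Vs)%:R + 2).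

Definition potential h : R :=
  f (cur h.1 :|: h.2) + ratio * f (cur h.1).

Lemma potential_le n h i q Rt : in_hybrid n h -> pending h.1 = i :: q ->
  Rt :&: h.2 != set0 -> Rt \subset Vs i :\: cur h.1 ->
  potential h <=
    \sum_e select (cur h.1) Rt e * potential (hybrid_next h (Rt, e)).
Proof.
move=> inh pend hit; rewrite subsetD => /andP [RV disR]; have [_ dis _] := inh.
under eq_bigr do rewrite /potential /= (cur_next _ pend).
apply: (hybrid_potential_le (Vs := Vs) (cap := cap)) => //.
  exact: in_hybrid_le inh.
rewrite lerD2r ler_nat (leq_trans (subset_leq_card RV)) //.
exact: (leq_bigmax i).
Qed.

Lemma potential_submartingale n h : in_hybrid n.+1 h ->
  potential h * survival h <=
  \sum_x hybrid_step h x * (potential (hybrid_next h x) * survival (hybrid_next h x)).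
Proof.
move=> inh; have [i [q [pend lt_cap]]] := in_hybrid_pending inh.
set hitp := hit_prob Vs cap delta i #|cur h.1 :&: Vs i|.
have hit_gt0 : 0 < hitp by exact: hit_prob_gt0.
under eq_bigr do rewrite mulrCA (survival_next _ inh pend lt_cap) mulrCA mulrA.
rewrite -mulr_suml (sum_hybrid_step predT (fun x => potential (hybrid_next h x)) pend).
rewrite mulrA ler_pdivlMr // mulrAC ler_wpM2r //; first exact/ltW/all_hit_prob_gt0.
rewrite -(sum_hit_sample_prob i inh) mulr_sumr.
apply: ler_sum => Rt _; rewrite mulrC.
have [->|nz] := eqVneq (hit_sample_prob i (cur h.1) h.2 Rt) 0; first by rewrite !mul0r.
have [hit sub] := hit_sample_prob_supp nz.
by rewrite ler_wpM2l ?hit_sample_prob_ge0 // (potential_le inh pend hit sub).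
Qed.

Lemma survivors_expect_ge O : f set0 = 0 ->
  in_hybrid (budget cap) (init_state, O) ->
  f O <= (ratio + 1) * cond_expect Vs f gamma' alpha' delta (survivors O)
                         (fun w => f (output Vs w)).
Proof.
move=> f0 inh; rewrite /cond_expect (Pr_survivorsE inh) mulrA.
rewrite ler_pdivlMr ?all_hit_prob_gt0 //.
have := walk_submartingale in_hybrid_next hybrid_step_ge0 potential_submartingale inh.
rewrite /potential /survival /= set0U f0 mulr0 addr0 => /le_trans; apply.
rewrite mulr_sumr [leRHS]big_mkcond /=; apply: ler_sum => w _.
have := hybrid_weightE O w; case: ifP => [w_surv|_] wE; last by rewrite wE mul0r.
have in_end : in_hybrid 0 (foldl hybrid_next (init_state, O) w).
  apply: (walk_invariant in_hybrid_next); first by rewrite size_tuple addn0.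
  by move: w_surv; rewrite inE.
have := survival_end in_end; rewrite /survival (in_hybrid_end in_end) setU0 => ->.
by rewrite foldl_hybrid_next wE mulr1 /output mulrCA mulrDl mul1r addrC.
Qed.

End HybridWalk.

Theorem theorem2 (R : realType) :
  exists C : R,
  forall (V : finType) (k : nat) (Vs : 'I_k -> {set V}) (cap : 'I_k -> nat)
    (f : {set V} -> R) (gamma alpha gamma' alpha' delta : R)
    (Sstar : {set V}),
  (0 < k)%N ->
  is_partition Vs ->
  (forall i, (1 <= cap i <= #|Vs i|)%N) ->
  (forall S, 0 <= f S) ->
  monotone f ->
  f set0 = 0 ->
  is_pm_dr_ratio Vs cap f gamma ->
  is_pm_curvature Vs cap f alpha ->
  0 < gamma' -> gamma' <= gamma ->
  alpha <= alpha' -> alpha' <= 1 ->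
  0 <= delta -> delta <= 1 ->
  is_optimal Vs cap f Sstar ->
  (exists G : {set trajectory cap},
    [/\ sampling_event Vs f gamma' alpha' delta G,
        1 - delta <= Pr Vs f gamma' alpha' delta G
      & f Sstar <=
          ((gamma'^-1 + alpha' - 1) * (1 - ((max_part Vs)%:R + 2)^-1) + 1)
          * cond_expect Vs f gamma' alpha' delta G
              (fun w => f (output Vs w))])
  /\
  ((1 < budget cap)%N -> 0 < delta ->
    forall w : trajectory cap,
      0 < traj_prob Vs f gamma' alpha' delta w ->
      (num_queries Vs w)%:R <=
        C * #|V|%:R * ln (budget cap)%:R * ln ((budget cap)%:R / delta)).
Proof.
exists 11 => V k Vs cap f gamma alpha gamma' alpha' delta Sstar k0 part capV _ mono.
move=> f0 [/andP [_ gamma1] dr _] [/andP [alpha0 _] curv _] g0 g_le a_le a1 d0 d1.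
move=> [feas _]; split=> [|b1 d_gt0 w w_gt0]; last first.
  by rewrite (num_queriesE part capV (lt0r_neq0 w_gt0)); exact: queries_left_set0_le.
have [T ST capT] := feasible_extend part capV feas.
have inh := in_hybrid_init capV capT.
exists (survivors Vs cap f gamma' alpha' delta T); split.
- exact: sampling_event_survivors.
- rewrite Pr_survivorsE // all_hit_prob_set0_ge //.
  by apply: leq_trans (cap_le_budget cap (Ordinal k0)); case/andP: (capV (Ordinal k0)).
apply: le_trans (mono _ _ ST) _; apply: survivors_expect_ge => //.
- exact: le_trans gamma1.
- exact: le_trans a_le.
- exact: pm_dr_bound_le dr.
- exact: pm_curvature_bound_ge curv.
Qed.
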